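(* Let $U$ be an open set of $\mathbb{H}\cong\mathbb{C}^2$ and let $f$ and $g$ be two w-hypermeromorphic functions on $U$. Let $h=f+g=h_1+h_2\mathbf{j}$, with complex components $h_1,h_2$, and assume that $h$ does not vanish identically on any nonempty open subset of its domain of definition. Then the following conditions are equivalent: (i) the sum $h=f+g$ is w-hypermeromorphic; (ii) $h$ satisfies, where it is defined, the partial differential equation $$-\Big(\frac{\partial|h|}{\partial\overline z_1}+\mathbf{j}\frac{\partial|h|}{\partial\overline z_2}\Big)(\overline h_1-h_2\mathbf{j})+|h|\Big(\frac{\partial}{\partial\overline z_1}+\mathbf{j}\frac{\partial}{\partial\overline z_2}\Big)(\overline h_1-h_2\mathbf{j})=0.$$
   Context: A quaternion $q\in\mathbb{H}$ is written $q=z_1+z_2\mathbf{j}$ with $z_1,z_2\in\mathbb{C}$, where $\mathbf{j}^2=-1$ and $z\mathbf{j}=\mathbf{j}\overline z$ for $z\in\mathbb{C}$; this identifies $\mathbb{H}$ with $\mathbb{C}^2$. The notation $|q|$ means $|q|=z_1\overline z_1+z_2\overline z_2$ (the square of the Euclidean norm); so for a function $h=h_1+h_2\mathbf{j}$, $|h|=h_1\overline h_1+h_2\overline h_2$. The quaternionic conjugate is $\overline q=\overline z_1-z_2\mathbf{j}$, and the (right) inverse of $q\neq0$ is $q^{-1}=|q|^{-1}\overline q$. A function $f$ with values in $\mathbb{H}$ is written $f=f_1+f_2\mathbf{j}$ with complex-valued components $f_1,f_2$. ''Defined almost everywhere on $U$'' means defined (and $C^\infty$) on the complement in $U$ of a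 locally finite set of $C^\infty$ hypersurfaces; the sum of two such functions is defined on the intersection of their domains. The (right) inverse of $f$ is the function $q\mapsto f(q)^{-1}$, defined at the points of the domain of $f$ where $f(q)\neq0$; thus $f^{-1}=|f|^{-1}(\overline f_1-f_2\mathbf{j})$. The modified Cauchy-Fueter operator is $$\mathcal{D}f=\frac12\Big(\frac{\partial}{\partial\overline z_1}+\mathbf{j}\frac{\partial}{\partial\overline z_2}\Big)f,$$ where $\partial/\partial\overline z_k$ acts by $\frac{\partial f}{\partial\overline z_k}=\frac{\partial f_1}{\partial\overline z_k}+\frac{\partial f_2}{\partial\overline z_k}\mathbf{j}$ (usual Wirtinger derivatives of the components). A $C^\infty$ function $f$ on an open set is hyperholomorphic if $\mathcal{D}f=0$ there. A w-hypermeromorphic function on $U$ is a function defined almost everywhere on $U$, hyperholomorphic where it is defined, not vanishing identically on any nonempty open subset of its domain, whose right inverse is hyperholomorphic where that inverse is defined (that is, at the points of the domain where the function is nonzero). *)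

(* Defs.v *)
From Stdlib Require Import Reals List.
From Coquelicot Require Import Coquelicot.

Open Scope R_scope.

(* The pair (z1, z2) stands for z1 + z2 j; the topology is that of C x C. *)
Definition quat : Type := (C * C)%type.

Declare Scope quat_scope.
Delimit Scope quat_scope with quat.
Bind Scope quat_scope with quat.

Definition qzero : quat := (RtoC 0, RtoC 0).
Definition qj : quat := (RtoC 0, RtoC 1).
Definition ofC (z : C) : quat := (z, RtoC 0).
Definition qadd (p q : quat) : quat := (fst p + fst q, snd p + snd q)%C.
Definition qopp (p : quat) : quat := (- fst p, - snd p)%C.

(* (a + b j) (c + d j), expanded with z j = j (Cconj z) and j j = -1. *)
Definition qmul (p q : quat) : quat :=
  (fst p * fst q - snd p * Cconj (snd q),
   fst p * snd q + snd p * Cconj (fst q))%C.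

Notation "p + q" := (qadd p q) : quat_scope.
Notation "- p" := (qopp p) : quat_scope.
Notation "p * q" := (qmul p q) : quat_scope.

Definition qconj (q : quat) : quat := (Cconj (fst q), - snd q)%C.

(* The square of the Euclidean norm, as a complex number. *)
Definition qabs (q : quat) : C :=
  (fst q * Cconj (fst q) + snd q * Cconj (snd q))%C.

Definition qinv (q : quat) : quat := (ofC (/ qabs q)%C * qconj q)%quat.

Inductive axis := axis1 | axis2.

Definition axis_vec (k : axis) (z : C) : quat :=
  match k with axis1 => (z, RtoC 0) | axis2 => (RtoC 0, z) end.

Definition basis : list quat :=
  axis_vec axis1 (RtoC 1) :: axis_vec axis1 Ci ::
  axis_vec axis2 (RtoC 1) :: axis_vec axis2 Ci :: nil.

Definition along (q e : quat) (t : R) : quat := (q + ofC (RtoC t) * e)%quat.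

Definition partial (e : quat) (u : quat -> R) (q : quat) : R :=
  Derive (fun t => u (along q e t)) 0.

Fixpoint Ck (n : nat) (D : quat -> Prop) (u : quat -> R) : Prop :=
  (forall q, D q -> continuous u q) /\
  match n with
  | O => True
  | S m => forall e, In e basis ->
      (forall q, D q -> ex_derive (fun t => u (along q e t)) 0) /\
      Ck m D (partial e u)
  end.

Definition smooth (D : quat -> Prop) (u : quat -> R) : Prop :=
  forall n, Ck n D u.

Definition smoothC (D : quat -> Prop) (u : quat -> C) : Prop :=
  smooth D (fun q => Re (u q)) /\ smooth D (fun q => Im (u q)).

Definition smoothH (D : quat -> Prop) (f : quat -> quat) : Prop :=
  smoothC D (fun q => fst (f q)) /\ smoothC D (fun q => snd (f q)).

Definition partialC (e : quat) (u : quat -> C) (q : quat) : C :=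
  (partial e (fun p => Re (u p)) q, partial e (fun p => Im (u p)) q).

Definition dzbarC (k : axis) (u : quat -> C) (q : quat) : C :=
  (/ 2 * (partialC (axis_vec k 1) u q + Ci * partialC (axis_vec k Ci) u q))%C.

Definition dzbar (k : axis) (f : quat -> quat) (q : quat) : quat :=
  (dzbarC k (fun p => fst (f p)) q, dzbarC k (fun p => snd (f p)) q).

(* d/dzbar1 + j d/dzbar2, without the factor 1/2. *)
Definition dbar (f : quat -> quat) (q : quat) : quat :=
  (dzbar axis1 f q + qj * dzbar axis2 f q)%quat.

Definition cauchy_fueter (f : quat -> quat) (q : quat) : quat :=
  (ofC (/ 2)%C * dbar f q)%quat.

Definition hyperholomorphic (D : quat -> Prop) (f : quat -> quat) : Prop :=
  open D /\ smoothH D f /\ forall q, D q -> cauchy_fueter f q = qzero.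

(* A closed smooth submanifold of U of real codimension 1: near each of its
   points it is the zero set of a smooth real function without critical
   points. Closedness in U makes the complement in U of a locally finite set
   of hypersurfaces open. *)
Definition hypersurface (U S : quat -> Prop) : Prop :=
  (forall q, S q -> U q) /\
  (forall q, U q -> ~ S q -> locally q (fun p => ~ S p)) /\
  (forall q, S q ->
     exists (V : quat -> Prop) (phi : quat -> R),
       open V /\ V q /\ smooth V phi /\
       (forall p, V p -> exists e, In e basis /\ partial e phi p <> 0) /\
       (forall p, V p -> (S p <-> phi p = 0))).

Definition locally_finite (U : quat -> Prop)
    (F : (quat -> Prop) -> Prop) : Prop :=
  forall q, U q -> exists (V : quat -> Prop) (l : list (quat -> Prop)),
    open V /\ V q /\
    forall S, F S -> (exists p, V p /\ S p) -> In S l.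

(* A partial function; the values of fn outside dom are irrelevant. *)
Record pfun := Pfun { dom : quat -> Prop; fn : quat -> quat }.

Definition padd (f g : pfun) : pfun :=
  Pfun (fun q => dom f q /\ dom g q) (fun q => (fn f q + fn g q)%quat).

Definition pinv (f : pfun) : pfun :=
  Pfun (fun q => dom f q /\ fn f q <> qzero) (fun q => qinv (fn f q)).

Definition defined_ae (U : quat -> Prop) (f : pfun) : Prop :=
  (exists F : (quat -> Prop) -> Prop,
     (forall S, F S -> hypersurface U S) /\
     locally_finite U F /\
     (forall q, dom f q <-> U q /\ forall S, F S -> ~ S q)) /\
  smoothH (dom f) (fn f).

Definition nowhere_identically_zero (f : pfun) : Prop :=
  forall V : quat -> Prop,
    open V -> (exists q, V q) -> (forall q, V q -> dom f q) ->
    exists q, V q /\ fn f q <> qzero.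

Definition w_hypermeromorphic (U : quat -> Prop) (f : pfun) : Prop :=
  defined_ae U f /\
  hyperholomorphic (dom f) (fn f) /\
  nowhere_identically_zero f /\
  hyperholomorphic (dom (pinv f)) (fn (pinv f)).

(* Main.v *)
Require Import Defs.
From Stdlib Require Import Reals List Lra.
From Coquelicot Require Import Coquelicot.

(** The Wirtinger derivatives obey the Leibniz rule and [|h|] is real, so
    multiplying [D (|h|^-1 * conj h)] by [2 |h|^2] gives exactly the left-hand
    side of (ii) at the points where [h <> 0].  At the zeros of [h] both [|h|]
    and [conj h] vanish and (ii) holds trivially.  All the other requirements
    on [f + g] are stable under sums. *)

(** * Partial derivatives of real functions *)

(** Unfolding stops at the quaternion and complex operations: real arithmetic and [Derive] stay
    folded, so [quat_ext] leaves one real identity per coordinate, ready for [ring] or [field]. *)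
Ltac quat_unfold :=
  cbv beta iota delta [along qzero qconj qabs ofC qj qopp qadd qmul Cinv Cminus
    Cplus Cmult Copp Cconj Ci RtoC Re Im fst snd].

Ltac quat_ext := quat_unfold; repeat apply (f_equal2 pair).

Lemma along_0 (q e : quat) : along q e 0 = q.
Proof.
  destruct q as [[a b] [c d]], e as [[a' b'] [c' d']].
  quat_ext; ring.
Qed.

(** The line through [q] in direction [e] is continuous in [t]. This turns equalities valid near [q]
    into equalities of functions of [t] near 0, which may then be differentiated. *)
Lemma locally_along (D : quat -> Prop) (q e : quat) :
  locally q D -> locally 0 (fun t => D (along q e t)).
Proof.
  intros [eps HD].
  assert (Hc : forall x y : R, locally 0 (fun t => ball x eps (x + t * y))).
  { intros x y.
    assert (C : continuous (fun t => x + t * y) 0).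
    { apply (ex_derive_continuous (fun t => x + t * y)); auto_derive; trivial. }
    unfold continuous in C.
    replace (x + 0 * y) with x in C by ring.
    exact (C (ball x eps) (locally_ball x eps)). }
  (* Balls of [quat] are products of intervals in the four real coordinates, so four instances of
     [Hc] suffice. *)
  destruct q as [[a b] [c d]], e as [[a' b'] [c' d']].
  generalize (filter_and _ _ (filter_and _ _ (Hc a a') (Hc b b'))
                (filter_and _ _ (Hc c c') (Hc d d'))).
  apply filter_imp; intros t [[Ha Hb] [Hc' Hd]]; apply HD.
  replace (along _ _ t)
    with (((a + t * a', b + t * b'), (c + t * c', d + t * d')) : quat).
  - split; split; assumption.
  - quat_ext; ring.
Qed.

Definition has_partial (e : quat) (u : quat -> R) (q : quat) : Prop :=
  ex_derive (fun t => u (along q e t)) 0.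

Lemma partial_ext_loc (e : quat) (u v : quat -> R) (q : quat) :
  locally q (fun p => u p = v p) -> partial e u q = partial e v q.
Proof.
  intro H; apply Derive_ext_loc, (locally_along (fun p => u p = v p)), H.
Qed.

Lemma partial_ext (e : quat) (u v : quat -> R) (q : quat) :
  (forall p, u p = v p) -> partial e u q = partial e v q.
Proof. intro H; apply Derive_ext; intro t; apply H. Qed.

Lemma partial_opp (e : quat) (u : quat -> R) (q : quat) :
  partial e (fun p => - u p) q = - partial e u q.
Proof. apply Derive_opp. Qed.

Lemma partial_plus (e : quat) (u v : quat -> R) (q : quat) :
  has_partial e u q -> has_partial e v q ->
  partial e (fun p => u p + v p) q = partial e u q + partial e v q.
Proof. intros Hu Hv; exact (Derive_plus _ _ _ Hu Hv). Qed.

Lemma partial_mult (e : quat) (u v : quat -> R) (q : quat) :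
  has_partial e u q -> has_partial e v q ->
  partial e (fun p => u p * v p) q = partial e u q * v q + u q * partial e v q.
Proof.
  intros Hu Hv; unfold partial.
  rewrite (Derive_mult _ _ _ Hu Hv), along_0; reflexivity.
Qed.

Lemma has_partial_inv (e : quat) (u : quat -> R) (q : quat) :
  has_partial e u q -> u q <> 0 -> has_partial e (fun p => / u p) q.
Proof.
  intros Hu H; apply (ex_derive_inv (fun t => u (along q e t))); trivial.
  rewrite along_0; exact H.
Qed.

Lemma partial_inv (e : quat) (u : quat -> R) (q : quat) :
  has_partial e u q -> u q <> 0 ->
  partial e (fun p => / u p) q = - partial e u q * (/ u q * / u q).
Proof.
  intros Hu H; unfold partial.
  rewrite (Derive_inv (fun t => u (along q e t)));
    rewrite ?along_0; trivial; field; exact H.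
Qed.

Lemma partial_div (e : quat) (u v : quat -> R) (q : quat) :
  has_partial e u q -> has_partial e v q -> v q <> 0 ->
  partial e (fun p => u p / v p) q =
  (partial e u q * v q - u q * partial e v q) / (v q * v q).
Proof.
  intros Hu Hv H; unfold Rdiv at 1.
  rewrite partial_mult, partial_inv by auto using has_partial_inv.
  field; exact H.
Qed.

(** * Functions of class [C^k] *)

Lemma Ck_sub (n : nat) (D D' : quat -> Prop) (u : quat -> R) :
  (forall q, D' q -> D q) -> Ck n D u -> Ck n D' u.
Proof.
  intro HD; revert u; induction n as [|n IH]; intros u [Hc Hd].
  - split; auto.
  - split; auto; intros e He; destruct (Hd e He) as [H1 H2]; auto.
Qed.

Lemma Ck_pred (n : nat) (D : quat -> Prop) (u : quat -> R) :
  Ck (S n) D u -> Ck n D u.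
Proof.
  revert u; induction n as [|n IH]; intros u [Hc Hd]; split; auto.
  intros e He; destruct (Hd e He) as [H1 H2]; auto.
Qed.

(** Since [D] is open, agreement on [D] is agreement near each of its points, so the partial
    derivatives agree on [D] too and the induction goes on. The closure lemmas below use this to
    replace a partial derivative by a formula valid on [D]. *)
Lemma Ck_ext (n : nat) (D : quat -> Prop) (u v : quat -> R) :
  open D -> (forall q, D q -> u q = v q) -> Ck n D u -> Ck n D v.
Proof.
  intro HD; revert u v; induction n as [|n IH]; intros u v E [Hc Hd].
  all: assert (L : forall q, D q -> locally q (fun p => u p = v p))
         by (apply locally_open; assumption).
  all: split; [intros q Hq; exact (continuous_ext_loc _ _ _ (L q Hq) (Hc q Hq))|].
  - exact I.
  - intros e He; destruct (Hd e He) as [H1 H2]; split.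
    + intros q Hq; apply (ex_derive_ext_loc (fun t => u (along q e t))); auto.
      exact (locally_along (fun p => u p = v p) q e (L q Hq)).
    + apply (IH (partial e u)); trivial.
      intros q Hq; apply partial_ext_loc; auto.
Qed.

Lemma Ck_opp (n : nat) (D : quat -> Prop) (u : quat -> R) :
  open D -> Ck n D u -> Ck n D (fun q => - u q).
Proof.
  intro HD; revert u; induction n as [|n IH]; intros u [Hc Hd].
  all: split; [intros q Hq; apply (continuous_opp u); auto|].
  - exact I.
  - intros e He; destruct (Hd e He) as [H1 H2]; split.
    + intros q Hq; apply (ex_derive_opp (fun t => u (along q e t))), H1, Hq.
    + apply (Ck_ext n D (fun q => - partial e u q)); auto.
      intros q Hq; symmetry; apply partial_opp.
Qed.

Lemma Ck_plus (n : nat) (D : quat -> Prop) (u v : quat -> R) :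
  open D -> Ck n D u -> Ck n D v -> Ck n D (fun q => u q + v q).
Proof.
  intro HD; revert u v; induction n as [|n IH]; intros u v [Hc Hd] [Hc' Hd'].
  all: split; [intros q Hq; apply (continuous_plus u v); auto|].
  - exact I.
  - intros e He; destruct (Hd e He) as [H1 H2], (Hd' e He) as [H1' H2']; split.
    + intros q Hq; apply (ex_derive_plus (fun t => u (along q e t))); auto.
    + apply (Ck_ext n D (fun q => partial e u q + partial e v q)); auto.
      intros q Hq; symmetry; apply partial_plus; [apply H1|apply H1']; exact Hq.
Qed.

Lemma Ck_mult (n : nat) (D : quat -> Prop) (u v : quat -> R) :
  open D -> Ck n D u -> Ck n D v -> Ck n D (fun q => u q * v q).
Proof.
  intro HD; revert u v; induction n as [|n IH]; intros u v Hu Hv.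
  all: split; [intros q Hq; apply (continuous_mult u v); [apply Hu|apply Hv]; exact Hq|].
  - exact I.
  - intros e He.
    destruct (proj2 Hu e He) as [H1 H2], (proj2 Hv e He) as [H1' H2']; split.
    + intros q Hq; apply (ex_derive_mult (fun t => u (along q e t))); auto.
    + apply (Ck_ext n D (fun q => partial e u q * v q + u q * partial e v q)); auto.
      * intros q Hq; symmetry; apply partial_mult; [apply H1|apply H1']; exact Hq.
      (* The Leibniz formula also contains [u] and [v] themselves, which are of class [S n] and are
         lowered to class [n]. *)
      * apply Ck_plus; auto using Ck_pred.
Qed.

(** The derivative of [/ u] is a product of [- partial e u] and two copies of [/ u]; the induction
    hypothesis gives these copies at order [n], and [Ck_mult] concludes. *)
Lemma Ck_inv (n : nat) (D : quat -> Prop) (u : quat -> R) :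
  open D -> (forall q, D q -> u q <> 0) -> Ck n D u -> Ck n D (fun q => / u q).
Proof.
  intros HD Hn; induction n as [|n IH]; intros Hu.
  all: split;
    [intros q Hq; apply (continuous_comp u Rinv);
     [apply Hu, Hq | apply (continuous_Rinv (u q)), Hn, Hq]|].
  - exact I.
  - intros e He; destruct (proj2 Hu e He) as [H1 H2]; split.
    + intros q Hq; apply has_partial_inv; [apply H1|apply Hn]; exact Hq.
    + apply (Ck_ext n D (fun q => - partial e u q * (/ u q * / u q))); auto.
      * intros q Hq; symmetry; apply partial_inv; [apply H1|apply Hn]; exact Hq.
      * auto using Ck_mult, Ck_opp, Ck_pred.
Qed.

Section Smooth.
Variable D : quat -> Prop.
Hypothesis HD : open D.

Lemma smooth_sub (D' : quat -> Prop) (u : quat -> R) :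
  (forall q, D' q -> D q) -> smooth D u -> smooth D' u.
Proof. intros H Hu n; exact (Ck_sub n D D' u H (Hu n)). Qed.

Lemma smooth_ext (u v : quat -> R) :
  (forall q, D q -> u q = v q) -> smooth D u -> smooth D v.
Proof. intros H Hu n; exact (Ck_ext n D u v HD H (Hu n)). Qed.

Lemma smooth_opp (u : quat -> R) : smooth D u -> smooth D (fun q => - u q).
Proof. intros Hu n; apply Ck_opp; auto. Qed.

Lemma smooth_plus (u v : quat -> R) :
  smooth D u -> smooth D v -> smooth D (fun q => u q + v q).
Proof. intros Hu Hv n; apply Ck_plus; auto. Qed.

Lemma smooth_mult (u v : quat -> R) :
  smooth D u -> smooth D v -> smooth D (fun q => u q * v q).
Proof. intros Hu Hv n; apply Ck_mult; auto. Qed.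

Lemma smooth_div (u v : quat -> R) :
  (forall q, D q -> v q <> 0) ->
  smooth D u -> smooth D v -> smooth D (fun q => u q / v q).
Proof.
  intros Hn Hu Hv n; apply (Ck_mult n D u (fun q => / v q)); auto using Ck_inv.
Qed.

Lemma smooth_continuous (u : quat -> R) (q : quat) :
  smooth D u -> D q -> continuous u q.
Proof. intros Hu; apply (Hu 0%nat). Qed.

Lemma smooth_has_partial (u : quat -> R) (e q : quat) :
  smooth D u -> In e basis -> D q -> has_partial e u q.
Proof. intros Hu He; apply (proj2 (Hu 1%nat) e He). Qed.

Lemma smoothH_plus (f g : quat -> quat) :
  smoothH D f -> smoothH D g -> smoothH D (fun q => (f q + g q)%quat).
Proof.
  intros [[F1 F2] [F3 F4]] [[G1 G2] [G3 G4]].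
  split; split; apply smooth_plus; assumption.
Qed.

End Smooth.

Lemma smoothH_sub (D D' : quat -> Prop) (f : quat -> quat) :
  (forall q, D' q -> D q) -> smoothH D f -> smoothH D' f.
Proof.
  intros H [[F1 F2] [F3 F4]]; split; split; apply (smooth_sub D); assumption.
Qed.

(** * The inverse of a quaternion-valued function *)

(** A real-valued form of [qabs], to which the calculus of real functions applies directly. *)
Definition qnorm2 (q : quat) : R :=
  Re (fst q) * Re (fst q) + Im (fst q) * Im (fst q) +
  (Re (snd q) * Re (snd q) + Im (snd q) * Im (snd q)).

Lemma qabs_qnorm2 (q : quat) : qabs q = RtoC (qnorm2 q).
Proof.
  destruct q as [[a b] [c d]].
  unfold qabs, qnorm2, Cplus, Cmult, Cconj, RtoC; simpl; f_equal; ring.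
Qed.

Lemma qnorm2_eq0 (q : quat) : qnorm2 q = 0 -> q = qzero.
Proof.
  destruct q as [[a b] [c d]]; unfold qnorm2, qzero, RtoC; simpl; intro H.
  assert (a = 0 /\ b = 0 /\ c = 0 /\ d = 0) as (-> & -> & -> & ->).
  { repeat split; nra. }
  reflexivity.
Qed.

Lemma qnorm2_neq0 (q : quat) : q <> qzero <-> qnorm2 q <> 0.
Proof.
  split.
  - intros H N; apply H, qnorm2_eq0, N.
  - intros H ->; apply H; unfold qnorm2, qzero, RtoC; simpl; ring.
Qed.

(** Division by a real number is done on each component in [R], so that the real quotient rule
    applies to the real and imaginary parts. *)
Definition Cdivr (z : C) (r : R) : C := (Re z / r, Im z / r).

(* At [q = 0] both sides are [0], since [0 * / 0 = 0] in [R]. *)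
Lemma qinv_coords (q : quat) :
  qinv q = (Cdivr (fst (qconj q)) (qnorm2 q), Cdivr (snd (qconj q)) (qnorm2 q)).
Proof.
  unfold qinv, Cdivr; rewrite qabs_qnorm2.
  destruct (Req_dec (qnorm2 q) 0) as [N|N].
  - rewrite N, (qnorm2_eq0 q N); unfold Rdiv.
    quat_ext; ring.
  - revert N; generalize (qnorm2 q); intros n N.
    destruct q as [[a b] [c d]].
    quat_ext; field; auto.
Qed.

Lemma smoothC_div (D : quat -> Prop) (u : quat -> C) (n : quat -> R) :
  open D -> (forall q, D q -> n q <> 0) -> smoothC D u -> smooth D n ->
  smoothC D (fun q => Cdivr (u q) (n q)).
Proof. intros HD N [U1 U2] Hn; split; apply smooth_div; assumption. Qed.

Lemma smoothH_conj (D : quat -> Prop) (h : quat -> quat) :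
  open D -> smoothH D h -> smoothH D (fun q => qconj (h q)).
Proof.
  intros HD [[A B] [C E]]; split; split; trivial; apply smooth_opp; assumption.
Qed.

Lemma smoothC_ext (D : quat -> Prop) (u v : quat -> C) :
  open D -> (forall q, u q = v q) -> smoothC D u -> smoothC D v.
Proof.
  intros HD E [U1 U2]; split;
    [apply (smooth_ext D HD (fun q => Re (u q)))
    |apply (smooth_ext D HD (fun q => Im (u q)))];
    trivial; intros q _; rewrite E; reflexivity.
Qed.

Section Inverse.
Variables (D : quat -> Prop) (h : quat -> quat).
Hypotheses (HD : open D) (Hh : smoothH D h).

Lemma smooth_qnorm2 : smooth D (fun q => qnorm2 (h q)).
Proof.
  destruct Hh as [[A B] [C E]]; unfold qnorm2.
  auto 6 using smooth_plus, smooth_mult.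
Qed.

(** Being nonzero means [qnorm2 (h q) <> 0], an open condition on a continuous real function. *)
Lemma open_nonzero : open (fun q => D q /\ h q <> qzero).
Proof.
  intros q [Hq N]; apply qnorm2_neq0 in N.
  apply filter_and; [apply HD, Hq|].
  apply (filter_imp (fun p => qnorm2 (h p) <> 0)).
  - intro p; apply qnorm2_neq0.
  - exact (smooth_continuous D _ q smooth_qnorm2 Hq _ (open_neq 0 _ N)).
Qed.

Lemma smoothH_inv : smoothH (fun q => D q /\ h q <> qzero) (fun q => qinv (h q)).
Proof.
  pose proof open_nonzero as HO.
  assert (HN : forall q, D q /\ h q <> qzero -> qnorm2 (h q) <> 0)
    by (intros q [_ Hq]; apply qnorm2_neq0, Hq).
  assert (HQ : smooth (fun q => D q /\ h q <> qzero) (fun q => qnorm2 (h q)))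
    by (apply (smooth_sub D); [tauto|apply smooth_qnorm2]).
  destruct (smoothH_sub D (fun q => D q /\ h q <> qzero) _
              (fun q H => proj1 H) (smoothH_conj D h HD Hh)) as [A B].
  split; (eapply smoothC_ext;
    [exact HO
    |intro q; rewrite qinv_coords; reflexivity
    |apply smoothC_div; assumption]).
Qed.

End Inverse.

(** * The Cauchy-Fueter operator *)

Lemma partialC_plus (D : quat -> Prop) (u v : quat -> C) (e q : quat) :
  smoothC D u -> smoothC D v -> In e basis -> D q ->
  partialC e (fun p => u p + v p)%C q = (partialC e u q + partialC e v q)%C.
Proof.
  intros [U1 U2] [V1 V2] He Hq; apply (f_equal2 pair).
  - exact (partial_plus e _ _ q (smooth_has_partial D _ e q U1 He Hq)
             (smooth_has_partial D _ e q V1 He Hq)).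
  - exact (partial_plus e _ _ q (smooth_has_partial D _ e q U2 He Hq)
             (smooth_has_partial D _ e q V2 He Hq)).
Qed.

Lemma dzbarC_plus (D : quat -> Prop) (u v : quat -> C) (k : axis) (q : quat) :
  smoothC D u -> smoothC D v -> D q ->
  dzbarC k (fun p => u p + v p)%C q = (dzbarC k u q + dzbarC k v q)%C.
Proof.
  intros Hu Hv Hq; unfold dzbarC.
  (* The side condition is that both directions of the axis [k] belong to [basis]. *)
  rewrite !(partialC_plus D u v) by (trivial; destruct k; simpl; auto).
  ring.
Qed.

Lemma dzbar_plus (D : quat -> Prop) (f g : quat -> quat) (k : axis) (q : quat) :
  smoothH D f -> smoothH D g -> D q ->
  dzbar k (fun p => (f p + g p)%quat) q = (dzbar k f q + dzbar k g q)%quat.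
Proof.
  intros [F1 F2] [G1 G2] Hq; apply (f_equal2 pair).
  - exact (dzbarC_plus D _ _ k q F1 G1 Hq).
  - exact (dzbarC_plus D _ _ k q F2 G2 Hq).
Qed.

Lemma cauchy_fueter_plus (D : quat -> Prop) (f g : quat -> quat) (q : quat) :
  smoothH D f -> smoothH D g -> D q ->
  cauchy_fueter (fun p => (f p + g p)%quat) q =
  (cauchy_fueter f q + cauchy_fueter g q)%quat.
Proof.
  intros Hf Hg Hq; unfold cauchy_fueter, dbar.
  rewrite !(dzbar_plus D f g) by assumption.
  destruct (dzbar axis1 f q) as [[a1 a2] [a3 a4]],
    (dzbar axis2 f q) as [[b1 b2] [b3 b4]],
    (dzbar axis1 g q) as [[c1 c2] [c3 c4]],
    (dzbar axis2 g q) as [[d1 d2] [d3 d4]].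
  quat_ext; ring.
Qed.

(** Serves to cancel two real factors: the 1/2 of the Cauchy-Fueter operator and the factor
    $|h|^{-2}$ of [dbar_qinv]. *)
Lemma qmul_real_eq0 (r : R) (q : quat) :
  r <> 0 -> (ofC (RtoC r) * q)%quat = qzero <-> q = qzero.
Proof.
  intro Hr; destruct q as [[a b] [c d]].
  unfold qmul, ofC, qzero, Cplus, Cminus, Cmult, Copp, Cconj, RtoC; simpl.
  split; intro H; injection H; intros.
  - quat_ext; apply (Rmult_eq_reg_l r); trivial; lra.
  - subst; quat_ext; ring.
Qed.

Lemma cauchy_fueter_eq0 (f : quat -> quat) (q : quat) :
  cauchy_fueter f q = qzero <-> dbar f q = qzero.
Proof.
  unfold cauchy_fueter; rewrite <- RtoC_inv by lra; apply qmul_real_eq0; lra.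
Qed.

(** The left-hand side of (ii), for an arbitrary function [h]. *)
Definition inv_defect (h : quat -> quat) (q : quat) : quat :=
  (- dbar (fun p => ofC (qabs (h p))) q * qconj (h q)
   + ofC (qabs (h q)) * dbar (fun p => qconj (h p)) q)%quat.

Lemma inv_defect_zero (h : quat -> quat) (q : quat) :
  h q = qzero -> inv_defect h q = qzero.
Proof.
  intro H; unfold inv_defect; rewrite H, qabs_qnorm2.
  replace (qnorm2 qzero) with 0 by (unfold qnorm2, qzero, RtoC; simpl; ring).
  (* Both derivatives become arbitrary quaternions, each multiplied by a factor that is zero. *)
  destruct (dbar _ q) as [[a b] [c d]]; destruct (dbar _ q) as [[a' b'] [c' d']].
  quat_ext; ring.
Qed.

Lemma partialC_div (D : quat -> Prop) (u : quat -> C) (n : quat -> R) (e q : quat) :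
  smoothC D u -> smooth D n -> In e basis -> D q -> n q <> 0 ->
  partialC e (fun p => Cdivr (u p) (n p)) q =
  Cdivr (RtoC (n q) * partialC e u q - RtoC (partial e n q) * u q) (n q * n q).
Proof.
  intros [U1 U2] Hn He Hq N.
  pose proof (smooth_has_partial D n e q Hn He Hq) as Pn.
  pose proof (partial_div e _ n q (smooth_has_partial D _ e q U1 He Hq) Pn N) as P1.
  pose proof (partial_div e _ n q (smooth_has_partial D _ e q U2 He Hq) Pn N) as P2.
  apply (f_equal2 pair); [refine (eq_trans P1 _)|refine (eq_trans P2 _)];
    unfold partialC, Re, Im; quat_unfold; field; exact N.
Qed.

Lemma partialC_real (e q : quat) (n : quat -> R) :
  partialC e (fun p => RtoC (n p)) q = RtoC (partial e n q).
Proof. apply (f_equal2 pair); [reflexivity|exact (Derive_const 0 0)]. Qed.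

Lemma dzbarC_div (D : quat -> Prop) (u : quat -> C) (n : quat -> R) (k : axis)
    (q : quat) :
  smoothC D u -> smooth D n -> D q -> n q <> 0 ->
  dzbarC k (fun p => Cdivr (u p) (n p)) q =
  Cdivr (RtoC (n q) * dzbarC k u q - dzbarC k (fun p => RtoC (n p)) q * u q)
    (n q * n q).
Proof.
  intros Hu Hn Hq N; unfold dzbarC; rewrite !partialC_real.
  rewrite !(partialC_div D u n) by (trivial; destruct k; simpl; auto).
  destruct (partialC (axis_vec k 1) u q) as [a b],
    (partialC (axis_vec k Ci) u q) as [c d], (u q) as [x y].
  unfold Cdivr; quat_ext; simpl; field; auto.
Qed.

Lemma dzbarC_ext (k : axis) (u v : quat -> C) (q : quat) :
  (forall p, u p = v p) -> dzbarC k u q = dzbarC k v q.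
Proof.
  intro E.
  assert (P : forall e, partialC e u q = partialC e v q)
    by (intro e; apply (f_equal2 pair); apply partial_ext; intro p; rewrite E;
        reflexivity).
  unfold dzbarC; rewrite !P; reflexivity.
Qed.

(** The quotient rule for $\overline h/|h|$ gives each Wirtinger derivative the denominator $|h|^2$.
    This number is real, hence commutes with [qj] and comes out of the sum; associativity moves [qj]
    onto the derivative of $|h|$. *)
Lemma dbar_qinv (D : quat -> Prop) (h : quat -> quat) (q : quat) :
  open D -> smoothH D h -> D q -> h q <> qzero ->
  dbar (fun p => qinv (h p)) q =
  (ofC (RtoC (/ (qnorm2 (h q) * qnorm2 (h q)))) * inv_defect h q)%quat.
Proof.
  intros HD Hh Hq N; apply qnorm2_neq0 in N.
  pose proof (smooth_qnorm2 D h HD Hh) as HQ.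
  destruct (smoothH_conj D h HD Hh) as [A B].
  (* The placeholder is instantiated by the quotient rule, once [qinv] is written in coordinates. *)
  assert (E1 : forall k, dzbarC k (fun p => fst (qinv (h p))) q = _)
    by (intro k; etransitivity;
        [apply dzbarC_ext; intro p; rewrite qinv_coords; reflexivity
        |exact (dzbarC_div D _ _ k q A HQ Hq N)]).
  assert (E2 : forall k, dzbarC k (fun p => snd (qinv (h p))) q = _)
    by (intro k; etransitivity;
        [apply dzbarC_ext; intro p; rewrite qinv_coords; reflexivity
        |exact (dzbarC_div D _ _ k q B HQ Hq N)]).
  assert (E3 : forall k, dzbarC k (fun p => fst (ofC (qabs (h p)))) q =
                         dzbarC k (fun p => RtoC (qnorm2 (h p))) q)
    by (intro k; apply dzbarC_ext; intro p; apply qabs_qnorm2).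
  assert (E4 : forall k, dzbarC k (fun p => snd (ofC (qabs (h p)))) q = RtoC 0).
  { intro k; unfold dzbarC, ofC; simpl.
    rewrite !partialC_real; unfold partial; rewrite Derive_const; ring. }
  unfold inv_defect, dbar, dzbar.
  rewrite qabs_qnorm2, !E1, !E2, !E3, !E4.
  (* With $|h|^{-2}$ as an independent variable [s], what remains is a polynomial identity in the
     values of $|h|$, $\overline h$ and their derivatives. *)
  clear; unfold Cdivr, Rdiv.
  generalize (/ (qnorm2 (h q) * qnorm2 (h q))) (qnorm2 (h q)); intros s n.
  destruct (qconj (h q)) as [[x1 x2] [x3 x4]],
    (dzbarC axis1 (fun p => fst (qconj (h p))) q) as [a1 a2],
    (dzbarC axis2 (fun p => fst (qconj (h p))) q) as [b1 b2],
    (dzbarC axis1 (fun p => snd (qconj (h p))) q) as [c1 c2],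
    (dzbarC axis2 (fun p => snd (qconj (h p))) q) as [d1 d2],
    (dzbarC axis1 (fun p => RtoC (qnorm2 (h p))) q) as [u1 u2],
    (dzbarC axis2 (fun p => RtoC (qnorm2 (h p))) q) as [v1 v2].
  quat_ext; ring.
Qed.

(** * Sums of functions defined almost everywhere *)

Lemma defined_ae_padd (U : quat -> Prop) (f g : pfun) :
  open (dom f) -> open (dom g) ->
  defined_ae U f -> defined_ae U g -> defined_ae U (padd f g).
Proof.
  intros Of Og [(F & F1 & F2 & F3) Sf] [(G & G1 & G2 & G3) Sg]; split.
  (* The exceptional hypersurfaces of the sum are those of [f] together with those of [g]; near a
     point, intersect the two neighbourhoods and concatenate the two finite lists. *)
  - exists (fun S => F S \/ G S); split; [|split].
    + intros S [HS|HS]; auto.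
    + intros q Hq.
      destruct (F2 q Hq) as (V & l & V1 & V2 & V3),
        (G2 q Hq) as (W & m & W1 & W2 & W3).
      exists (fun p => V p /\ W p), (l ++ m).
      split; [apply open_and; assumption|split; [auto|]].
      intros S [HS|HS] (p & [Hv Hw] & Hp); apply in_or_app; eauto.
    + intro q; simpl; rewrite F3, G3; split.
      * intros [[HU HF] [_ HG]]; split; [exact HU|intros S [HS|HS]; auto].
      * intros [HU HS]; repeat split; auto.
  - apply smoothH_plus; [apply open_and; assumption| |].
    + apply (smoothH_sub (dom f)); simpl; tauto.
    + apply (smoothH_sub (dom g)); simpl; tauto.
Qed.

Lemma hyperholomorphic_plus (D E : quat -> Prop) (f g : quat -> quat) :
  hyperholomorphic D f -> hyperholomorphic E g ->
  hyperholomorphic (fun q => D q /\ E q) (fun q => (f q + g q)%quat).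
Proof.
  intros (O1 & S1 & H1) (O2 & S2 & H2).
  assert (O : open (fun q => D q /\ E q)) by (apply open_and; assumption).
  assert (S1' : smoothH (fun q => D q /\ E q) f)
    by (apply (smoothH_sub D); tauto).
  assert (S2' : smoothH (fun q => D q /\ E q) g)
    by (apply (smoothH_sub E); tauto).
  split; [exact O|split; [apply smoothH_plus; assumption|]].
  intros q Hq; rewrite (cauchy_fueter_plus _ f g q S1' S2' Hq).
  rewrite H1, H2 by tauto.
  quat_ext; ring.
Qed.

(** Openness of the domain and smoothness of the inverse follow from those of [D] and [h], so only
    the differential equation remains. Off the zeros it is [inv_defect h q = qzero] up to a nonzero
    real factor. *)
Lemma hyperholomorphic_inv_iff (D : quat -> Prop) (h : quat -> quat) :
  open D -> smoothH D h ->
  hyperholomorphic (fun q => D q /\ h q <> qzero) (fun q => qinv (h q)) <->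
  (forall q, D q -> inv_defect h q = qzero).
Proof.
  intros HD Hh.
  assert (E : forall q, D q -> h q <> qzero ->
    cauchy_fueter (fun p => qinv (h p)) q = qzero <-> inv_defect h q = qzero).
  { intros q Hq N; rewrite cauchy_fueter_eq0, (dbar_qinv D h q HD Hh Hq N).
    apply qmul_real_eq0, Rinv_neq_0_compat; apply qnorm2_neq0 in N.
    apply Rmult_integral_contrapositive_currified; exact N. }
  split.
  - intros (_ & _ & H) q Hq.
    (* Hyperholomorphy of the inverse says nothing at the zeros of [h]; there [inv_defect_zero]
       supplies the equation. *)
    destruct (Req_dec (qnorm2 (h q)) 0) as [N|N].
    + apply inv_defect_zero, qnorm2_eq0, N.
    + apply qnorm2_neq0 in N; apply E; auto.
  - intro H; split; [|split].
    + exact (open_nonzero D h HD Hh).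
    + exact (smoothH_inv D h HD Hh).
    + intros q [Hq N]; apply E; auto.
Qed.

Theorem proposition4p1 (U : quat -> Prop) (f g : pfun)
    (hU : open U)
    (hf : w_hypermeromorphic U f) (hg : w_hypermeromorphic U g)
    (hh : nowhere_identically_zero (padd f g)) :
  w_hypermeromorphic U (padd f g) <->
  (forall q : quat, dom (padd f g) q ->
     (- dbar (fun p => ofC (qabs (fn (padd f g) p))) q
        * qconj (fn (padd f g) q)
      + ofC (qabs (fn (padd f g) q))
        * dbar (fun p => qconj (fn (padd f g) p)) q)%quat = qzero).
Proof.
  destruct hf as (Af & Hf & _ & _), hg as (Ag & Hg & _ & _).
  pose proof (hyperholomorphic_plus _ _ _ _ Hf Hg) as H.
  (* By conversion, one side of [I] is hyperholomorphy of [pinv (padd f g)] and the other is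
     (ii). *)
  pose proof (hyperholomorphic_inv_iff (dom (padd f g)) (fn (padd f g))
                (proj1 H) (proj1 (proj2 H))) as I.
  split.
  - intros (_ & _ & _ & K); exact (proj1 I K).
  - intro K; split; [|split; [exact H|split; [exact hh|exact (proj2 I K)]]].
    apply defined_ae_padd; trivial; [apply Hf|apply Hg].
Qed.
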